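(* Let $\mathcal U$ be a subset of a Hilbert space $\mathcal T$, let $\mathcal W=\mathbb R^d$, and for each $w\in\mathcal W$ let $F_w:\mathcal M\times\mathcal U\to\mathbb R$. Let $\theta:\mathcal M\times\mathcal U\to\mathbb R^d$ satisfy $\theta(P',u')\in\operatorname{argmin}_{w\in\mathcal W}F_w(P',u')$ for all $(P',u')$ (when there are multiple minimizers, $\theta$ selects one of them). Fix $(P,u)\in\mathcal M\times\mathcal U$ and suppose $\mathcal M$ is locally nonparametric at $P$. Suppose: (i) $\theta$ is continuous at $(P,u)$; (ii) $w\mapsto F_w(P,u)$ is twice continuously differentiable at $w(0):=\theta(P,u)$ with positive definite Hessian matrix $H_{P,u}$; and (iii) there exists a bounded linear operator $G_{P,u}:\dot{\mathcal M}_P\oplus\dot{\mathcal U}_u\to\mathbb R^d$ such that, for all $s\in\check{\mathcal M}_P$, $t\in\check{\mathcal U}_u$, $\{P_\epsilon\}\in\mathscr P(P,\mathcal M,s)$, $\{u_\epsilon\}\in\mathscr P(u,\mathcal U,t)$, and functions $\widetilde w:[0,1]\to\mathbb R^d$ satisfying $\widetilde w(\epsilon)\to w(0)$ as $\epsilon\to0$, $$F_{\widetilde w(\epsilon)}(P_\epsilon,u_\epsilon)-F_{\widetilde w(\epsilon)}(P,u)-F_{w(0)}(P_\epsilon,u_\epsilon)+F_{w(0)}(P,u)=\epsilon\,[\widetilde w(\epsilon)-w(0)]^\top G_{P,u}(s,t)+o\big(\max\{\|\widetilde w(\epsilon)-w(0)\|_2^2,\epsilon^2\}\big).$$ Then $\theta$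 is totally pathwise differentiable at $(P,u)$ with $$\dot\theta_{P,u}(s,t)=H_{P,u}^{-1}G_{P,u}(s,t)\qquad\text{and}\qquad\dot\theta_{P,u}^*(w)=H_{P,u}^{-1}G_{P,u}^*(w),$$ where $G_{P,u}^*$ denotes the Hermitian adjoint of $G_{P,u}$.
   Context: All Hilbert spaces are real; $\|\cdot\|_2$ is the Euclidean norm on $\mathbb R^d$. $\mathcal M$ is a set of probability distributions on a measurable space $\mathcal Z$; $\mathcal M\times\mathcal U$ carries the product topology of the Hellinger metric on $\mathcal M$ and the $\|\cdot\|_{\mathcal T}$-metric on $\mathcal U$. For $P\in\mathcal M$ and $s\in L^2(P)$, $\mathscr P(P,\mathcal M,s)$ is the collection of submodels $\{P_\epsilon:\epsilon\in[0,1]\}\subseteq\mathcal M$ with $P_{\epsilon=0}=P$ that are quadratic mean differentiable with score $s$ at $\epsilon=0$, i.e. $\int(\sqrt{dP_\epsilon}-\sqrt{dP}-\tfrac{\epsilon}{2}s\sqrt{dP})^2=o(\epsilon^2)$ as $\epsilon\to0$. The tangent set is $\check{\mathcal M}_P=\{s\in L^2(P):\mathscr P(P,\mathcal M,s)\neq\emptyset\}$ and the tangent space $\dot{\mathcal M}_P$ is the $L^2(P)$-closure of its linear span. $\mathcal M$ is locally nonparametric at $P$ if $\dot{\mathcal M}_P=\{s\in L^2(P):\int s\,dP=0\}$. For $u\in\mathcal U$, $t\in\mathcal T$, $\mathscr P(u,\mathcal U,t)$ is the set of paths $\{u_\epsilon:\epsilon\in[0,1]\}\subseteq\mathcal U$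 with $\|u_\epsilon-u-\epsilon t\|_{\mathcal T}=o(\epsilon)$; $\check{\mathcal U}_u=\{t\in\mathcal T:\mathscr P(u,\mathcal U,t)\ne\emptyset\}$ and $\dot{\mathcal U}_u$ is the $\mathcal T$-closure of its linear span. A map $\theta:\mathcal M\times\mathcal U\to\mathcal W$ ($\mathcal W$ Hilbert) is totally pathwise differentiable at $(P,u)$ if there is a continuous linear $\dot\theta_{P,u}:\dot{\mathcal M}_P\oplus\dot{\mathcal U}_u\to\mathcal W$ such that for all $s\in\check{\mathcal M}_P$, $t\in\check{\mathcal U}_u$, $\{P_\epsilon\}\in\mathscr P(P,\mathcal M,s)$, $\{u_\epsilon\}\in\mathscr P(u,\mathcal U,t)$, $\|\theta(P_\epsilon,u_\epsilon)-\theta(P,u)-\epsilon\,\dot\theta_{P,u}(s,t)\|_{\mathcal W}=o(\epsilon)$. Its Hermitian adjoint is $\dot\theta_{P,u}^*:\mathcal W\to\dot{\mathcal M}_P\oplus\dot{\mathcal U}_u$.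
   Formalization: The formal conclusion is θ̇(s,t) = −H⁻¹G(s,t) with adjoint w ↦ −G*(H⁻¹w): the stated sign fails for F_w(P,u) = (w−u)²/2, where G(s,t) = −t but θ̇ = t, and H⁻¹G*(w) is ill-typed for d ≠ 1. *)

(* Defs.v *)
From HB Require Import structures.
From mathcomp Require Import all_boot all_order all_algebra.
From mathcomp Require Import sesquilinear.
From mathcomp Require Import all_classical all_reals all_analysis.
Set Implicit Arguments.
Unset Strict Implicit.
Unset Printing Implicit Defensive.
Import Order.TTheory GRing.Theory Num.Theory.
Import numFieldNormedType.Exports.
Local Open Scope classical_set_scope.
Local Open Scope ring_scope.
Local Open Scope charge_scope.

(** Euclidean structure of R^d.  The library norm on ['cV[R]_d] is the
    sup-norm, which is only used for its topology. *)

Definition dotv (R : realType) (d : nat) (v w : 'cV[R]_d) : R :=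
  \sum_(i < d) v i 0 * w i 0.

Definition norm2 (R : realType) (d : nat) (v : 'cV[R]_d) : R :=
  Num.sqrt (dotv v v).

(** A real Hilbert space is a complete normed space [T] whose norm is induced
    by the inner product [ip]. *)
Definition hilbert_norm (R : realType) (T : completeNormedModType R)
    (ip : {dot T for idfun}) : Prop :=
  forall x : T, `|x| ^+ 2 = ip x x.

Section calculus.
Context (R : realType) (d : nat).
Implicit Types (f : 'cV[R]_d -> R) (w : 'cV[R]_d) (A : 'M[R]_d).

Definition partial (i : 'I_d) f : 'cV[R]_d -> R :=
  fun w => 'D_(delta_mx i 0) f w.

Definition hessian f w : 'M[R]_d :=
  \matrix_(i, j) partial i (partial j f) w.

Definition C2_at f w : Prop :=
  (\forall x \near w, differentiable f x /\
     forall i, differentiable (partial i f) x) /\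
  forall i j, {for w, continuous (partial i (partial j f))}.

Definition posdefmx A : Prop :=
  A^T = A /\ forall v : 'cV[R]_d, v != 0 -> 0 < dotv v (A *m v).

End calculus.

Section measures.
Context (dsp : measure_display) (Z : measurableType dsp) (R : realType).
Implicit Types P Q : probability Z R.

(** P + Q dominates both P and Q.  The integrals in [hellinger] and in
    [qmd_path] do not depend on the choice of the dominating measure. *)
Definition dominating P Q : set Z -> \bar R := measure_add P Q.

HB.instance Definition _ P Q := Measure.on (dominating P Q).

Lemma dominating_fin P Q : fin_num_fun (dominating P Q).
Proof.
move=> A mA; rewrite /dominating measure_addE fin_numD.
by rewrite !fin_num_measure.
Qed.

HB.instance Definition _ P Q :=
  Measure_isFinite.Build _ _ _ (dominating P Q) (@dominating_fin P Q).

Definition sqrt_density P Q (P0 : probability Z R) : Z -> R :=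
  fun z => Num.sqrt
    (fine (('d (charge_of_finite_measure P0) '/d (dominating P Q)) z)).

Definition hellinger P Q : R :=
  Num.sqrt (\int[dominating P Q]_z
    (sqrt_density P Q P z - sqrt_density P Q Q z) ^+ 2).

(** Elements of L^2(P) are handled through representatives: [L2 P] is the
    vector space of measurable square-integrable functions, which
    carries the L^2(P) semi-norm, with kernel the functions that vanish
    P-almost everywhere. *)
Definition L2 P := LfunType P (lee1n 2).

Definition ipL2 P (s s' : L2 P) : R := \int[P]_z (s z * s' z).

End measures.

Definition linspan (R : realType) (V : lmodType R) (A : set V) : set V :=
  [set x | exists n (a : 'I_n -> R) (v : 'I_n -> V),
     (forall i, A (v i)) /\ x = \sum_i a i *: v i].

Section model.
Context (dsp : measure_display) (Z : measurableType dsp) (R : realType).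
Variables (M : set (probability Z R)) (P : probability Z R).

(** The path is only constrained on [0, 1].  The integral is compared to
    [e ^+ 2] in the extended reals since it could a priori be infinite. *)
Definition qmd_path (s : L2 P) (Pe : R -> probability Z R) : Prop :=
  [/\ forall e, 0 <= e <= 1 -> M (Pe e),
      Pe 0 = P &
      forall c : R, 0 < c -> \forall e \near 0^'+,
        (\int[dominating (Pe e) P]_z
           ((sqrt_density (Pe e) P (Pe e) z - sqrt_density (Pe e) P P z
             - e / 2 * s z * sqrt_density (Pe e) P P z) ^+ 2)%:E
         <= (c * e ^+ 2)%:E)%E].

Definition tangent_setM : set (L2 P) := [set s | exists Pe, qmd_path s Pe].

Definition tangent_spaceM : set (L2 P) :=
  [set s | forall c : R, 0 < c -> exists2 g, linspan tangent_setM g &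
     ('N[P]_2%:E [EFin \o (s - g)%R] < c%:E)%E].

Definition locally_nonparametric : Prop :=
  tangent_spaceM = [set s : L2 P | \int[P]_z s z = 0].

End model.

Arguments tangent_setM {dsp Z R} M P _.
Arguments tangent_spaceM {dsp Z R} M P _.

Section parameter.
Context (R : realType) (T : completeNormedModType R).
Variables (U : set T) (u : T).

Definition hilbert_path (t : T) (ue : R -> T) : Prop :=
  (forall e, 0 <= e <= 1 -> U (ue e)) /\
  (fun e : R => ue e - u - e *: t) =o_ (0^'+) (fun e : R => e).

Definition tangent_setU : set T := [set t | exists ue, hilbert_path t ue].

Definition tangent_spaceU : set T := closure (linspan tangent_setU).

End parameter.

Section product.
Context (dsp : measure_display) (Z : measurableType dsp) (R : realType).
Context (T : completeNormedModType R) (ip : {dot T for idfun}).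
Context (M : set (probability Z R)) (U : set T).
Context (P : probability Z R) (u : T).

Definition tangent_sum : set (L2 P * T) :=
  tangent_spaceM M P `*` tangent_spaceU U u.

Definition ip_sum (x y : L2 P * T) : R := ipL2 x.1 y.1 + ip x.2 y.2.

Definition norm_sum (x : L2 P * T) : R := Num.sqrt (ip_sum x x).

Section operators.
Context (W : lmodType R) (ipW : W -> W -> R).

Definition normW (w : W) : R := Num.sqrt (ipW w w).

(** Bounded linear operators with domain [tangent_sum]; the values outside of
    the domain are irrelevant.  Boundedness forces such an operator to depend
    only on the P-a.e. class of the first component. *)
Definition bounded_linear_op (f : L2 P * T -> W) : Prop :=
  (forall (a : R) x y, tangent_sum x -> tangent_sum y ->
     f (a *: x + y) = a *: f x + f y) /\
  (exists C : R, forall x, tangent_sum x -> normW (f x) <= C * norm_sum x).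

(** This determines [g] up to P-a.e. equality of its first component. *)
Definition hermitian_adjoint (f : L2 P * T -> W) (g : W -> L2 P * T) : Prop :=
  forall w, tangent_sum (g w) /\
    forall x, tangent_sum x -> ipW w (f x) = ip_sum (g w) x.

Definition total_pathwise_derivative
    (theta : probability Z R -> T -> W) (dtheta : L2 P * T -> W) : Prop :=
  bounded_linear_op dtheta /\
  forall (s : L2 P) (t : T) (Pe : R -> probability Z R) (ue : R -> T),
    qmd_path M s Pe -> hilbert_path U u t ue ->
    (fun e : R => normW (theta (Pe e) (ue e) - theta P u - e *: dtheta (s, t)))
      =o_ (0^'+) (fun e : R => e).

End operators.

(** Continuity at (P, u) of the restriction of [theta] to M x U. *)
Definition continuous_at_model (d : nat)
    (theta : probability Z R -> T -> 'cV[R]_d) : Prop :=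
  forall c : R, 0 < c -> exists2 r : R, 0 < r &
    forall P' u', M P' -> U u' -> hellinger P' P < r -> `|u' - u| < r ->
      norm2 (theta P' u' - theta P u) < c.

End product.

(* Main.v *)
Require Import Defs.
From HB Require Import structures.
From mathcomp Require Import all_boot all_order all_algebra.
From mathcomp Require Import sesquilinear.
From mathcomp Require Import all_classical all_reals all_analysis.
From mathcomp Require Import measurable_realfun.
From mathcomp Require Import ring lra.
Set Implicit Arguments.
Unset Strict Implicit.
Unset Printing Implicit Defensive.
Import Order.TTheory GRing.Theory Num.Theory.
Import numFieldNormedType.Exports.
Local Open Scope classical_set_scope.
Local Open Scope ring_scope.

(* Along a path write w(e) = theta(P_e, u_e), h = w(e) - w(0), and let x be
   H^-1 G(s, t).  Quadratic mean differentiability forces P_e -> P in Hellinger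
   distance, so h -> 0 by (i).  As w(0) minimises F_w(P, u), Taylor's formula
   and (iii) give, up to o(max(|h|^2, e^2)),
     F_v(P_e, u_e) - F_{w(0)}(P_e, u_e) = k^T H k / 2 + e k^T H x
   with k = v - w(0), both at v = w(e) and at the competitor v = w(0) - e x.
   Since w(e) minimises the left-hand side, completing the square yields
   (h + e x)^T H (h + e x) = o(max(|h|^2, e^2)), whence |h + e x| = o(e) because
   H is coercive. *)

(** * Euclidean inner product and positive definite matrices *)

Section dot_product.
Context (R : realType) (d : nat).
Implicit Types (v w x : 'cV[R]_d) (A : 'M[R]_d).

Lemma dotvC v w : dotv v w = dotv w v.
Proof. by apply: eq_bigr => i _; rewrite mulrC. Qed.

Lemma dotvDl v w x : dotv (v + w) x = dotv v x + dotv w x.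
Proof. by rewrite -big_split; apply: eq_bigr => i _; rewrite mxE mulrDl. Qed.

Lemma dotvZl a v w : dotv (a *: v) w = a * dotv v w.
Proof. by rewrite mulr_sumr; apply: eq_bigr => i _; rewrite mxE mulrA. Qed.

Lemma dotvNl v w : dotv (- v) w = - dotv v w.
Proof. by rewrite -scaleN1r dotvZl mulN1r. Qed.

Lemma dotvDr x v w : dotv x (v + w) = dotv x v + dotv x w.
Proof. by rewrite ![dotv x _]dotvC dotvDl. Qed.

Lemma dotvZr a v w : dotv v (a *: w) = a * dotv v w.
Proof. by rewrite ![dotv v _]dotvC dotvZl. Qed.

Lemma dotvNr v w : dotv v (- w) = - dotv v w.
Proof. by rewrite ![dotv v _]dotvC dotvNl. Qed.

Lemma dotv_mulmxr v A w : dotv v (A *m w) = dotv (A^T *m v) w.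
Proof.
rewrite /dotv; under eq_bigr do rewrite mxE mulr_sumr.
rewrite exchange_big; apply: eq_bigr => j _; rewrite mxE mulr_suml.
by apply: eq_bigr => i _; rewrite mxE mulrCA mulrA.
Qed.

Lemma dotvv_ge0 v : 0 <= dotv v v.
Proof. by apply: sumr_ge0 => i _; rewrite -expr2 sqr_ge0. Qed.

Lemma norm2_ge0 v : 0 <= norm2 v.
Proof. exact: sqrtr_ge0. Qed.

Lemma sqr_norm2 v : norm2 v ^+ 2 = dotv v v.
Proof. exact/sqr_sqrtr/dotvv_ge0. Qed.

Lemma sqr_coord_le_dotvv v i : v i 0 ^+ 2 <= dotv v v.
Proof.
rewrite /dotv (bigD1 i)//= -expr2 lerDl sumr_ge0// => j _.
by rewrite -expr2 sqr_ge0.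
Qed.

Lemma normr_coord_le_norm2 v i : `|v i 0| <= norm2 v.
Proof.
by rewrite -(ler_pXn2r (ltn0Sn 1)) ?nnegrE ?norm2_ge0// sqr_norm2 real_normK
  ?num_real// sqr_coord_le_dotvv.
Qed.

Lemma mx_norm_le_norm2 v : `|v| <= norm2 v.
Proof.
rewrite [leLHS]mx_normrE; apply/bigmax_leP; split; first exact: norm2_ge0.
by move=> [i j] _ /=; rewrite (ord1 j) normr_coord_le_norm2.
Qed.

Lemma normr_coord_le_mx_norm v i : `|v i 0| <= `|v|.
Proof.
rewrite [leRHS]mx_normrE.
exact: (le_bigmax _ (fun ij => `|v ij.1 ij.2|) (i, 0)).
Qed.

Lemma double_dotv_le v w : 2 * dotv v w <= dotv v v + dotv w w.
Proof.
have := dotvv_ge0 (v - w); rewrite dotvDl !dotvDr !dotvNl !dotvNr (dotvC w v).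
lra.
Qed.

Lemma dotvv_add_le v w :
  dotv (v + w) (v + w) <= 2 * dotv v v + 2 * dotv w w.
Proof.
have := double_dotv_le v w; rewrite dotvDl !dotvDr (dotvC w v); lra.
Qed.

Lemma dotv_quad_shift A v w a : A^T = A ->
  dotv (v + a *: w) (A *m (v + a *: w)) =
  dotv v (A *m v) + 2 * a * dotv v (A *m w) + a ^+ 2 * dotv w (A *m w).
Proof.
move=> symA; rewrite mulmxDr -scalemxAr !dotvDl !dotvDr !dotvZl !dotvZr.
by rewrite (dotv_mulmxr w A v) symA (dotvC (A *m w) v); ring.
Qed.

(** Coordinate i of [A *m v] is at most the l1 norm of row i times [norm2 v]; summing squares gives
    the constant, and the added 1 makes it positive. *)
Lemma mulmx_dotv_bounded A :
  exists2 C : R, 0 < C & forall v, dotv (A *m v) (A *m v) <= C * dotv v v.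
Proof.
exists (1 + \sum_i (\sum_j `|A i j|) ^+ 2).
  by rewrite ltr_pwDl// sumr_ge0// => i _; exact: sqr_ge0.
move=> v; rewrite mulrDl mul1r -[leLHS]add0r lerD ?dotvv_ge0//.
rewrite mulr_suml; apply: ler_sum => i _.
rewrite -expr2 -real_normK ?num_real//.
rewrite -sqr_norm2 -exprMn ler_pXn2r ?nnegrE ?mulr_ge0 ?norm2_ge0 ?sumr_ge0//.
rewrite mxE (le_trans (ler_norm_sum _ _ _))// mulr_suml; apply: ler_sum => j _.
by rewrite normrM ler_wpM2l ?normr_coord_le_norm2.
Qed.

(** A row k of the left kernel satisfies k A = 0, so the form of [A] vanishes at k^T, which
    positivity allows only for k = 0. *)
Lemma posdefmx_unitmx A : posdefmx A -> A \in unitmx.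
Proof.
move=> [symA posA]; rewrite -row_free_unit -kermx_eq0; apply/eqP/row_matrixP.
move=> i; rewrite row0; apply/eqP; apply: contraT => k0.
have kA : row i (kermx A) *m A = 0 by rewrite -row_mul mulmx_ker row0.
have := posA (row i (kermx A))^T; rewrite -trmx0 (inj_eq trmx_inj) => /(_ k0).
rewrite -{2}symA -trmx_mul kA trmx0 /dotv big1 ?ltxx// => j _.
by rewrite [X in _ * X]mxE mulr0.
Qed.

(* Expanding the form of [A] at [v - t *: invmx A *m v] gives
   [v A v >= (2 t - t ^ 2 D) |v| ^ 2], optimal at [t = 1 / D]. *)
Lemma posdefmx_coercive A : posdefmx A ->
  exists2 l : R, 0 < l & forall v, l * dotv v v <= dotv v (A *m v).
Proof.
move=> pA; have [symA posA] := pA; have uA := posdefmx_unitmx pA.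
have [C C0 leC] := mulmx_dotv_bounded (invmx A).
(* From 2 v.x <= |v|^2 + |x|^2 and |x|^2 <= C |v|^2, this [D] bounds v.x by D |v|^2. *)
pose D := (1 + C) / 2; have D0 : 0 < D by rewrite divr_gt0 ?addr_gt0.
exists D^-1; first by rewrite invr_gt0.
move=> v; set x := invmx A *m v.
have Ax : A *m x = v by rewrite mulmxA mulmxV// mul1mx.
have vx : dotv v x <= D * dotv v v.
  have := leC v; have := double_dotv_le v x; rewrite -/x /D; lra.
have : 0 <= dotv (v - D^-1 *: x) (A *m (v - D^-1 *: x)).
  have [->|/posA/ltW//] := eqVneq (v - D^-1 *: x) 0.
  by rewrite mulmx0 dotvv_ge0.
rewrite mulmxBr -scalemxAr Ax dotvDl !dotvDr !dotvNl !dotvNr !dotvZr !dotvZl.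
rewrite (dotv_mulmxr x A v) symA Ax (dotvC x v).
have Dx : D^-1 * (D^-1 * dotv v x) <= D^-1 * dotv v v.
  by rewrite ler_pM2l ?invr_gt0// mulrC ler_pdivrMr// mulrC.
lra.
Qed.

End dot_product.

(** * First-order optimality and the second-order Taylor expansion *)

Section taylor.
Context (R : realType) (d : nat).
Implicit Types (f : 'cV[R]_d -> R) (v w h : 'cV[R]_d).

Lemma cV_sum_delta v : v = \sum_i v i 0 *: delta_mx i 0.
Proof.
by rewrite [LHS]matrix_sum_delta; apply: eq_bigr => i _; rewrite big_ord1.
Qed.

Lemma derive_sum_partial f w v : differentiable f w ->
  'D_v f w = \sum_i v i 0 * partial i f w.
Proof.
move=> df; rewrite deriveE// {1}(cV_sum_delta v) linear_sum.
by apply: eq_bigr => i _; rewrite linearZ /partial deriveE.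
Qed.

Lemma derive_at_min_ge0 f w v : differentiable f w ->
  (forall x, f w <= f x) -> 0 <= 'D_v f w.
Proof.
move=> df fmin; have dv : derivable f w v by exact: diff_derivable.
rewrite /derive cvg_at_rightE; last exact: dv.
apply: limr_ge.
  apply/cvg_ex; exists ('D_v f w); apply: cvg_dnbhs_at_right.
  exact: dv.
near=> t; rewrite mulr_ge0 ?invr_ge0// ?subr_ge0 ?fmin//.
Unshelve. all: by end_near. Qed.

(** The derivatives along [delta_mx i 0] and its opposite are both nonnegative, and they are
    opposite to each other. *)
Lemma partial_at_min f w i : differentiable f w ->
  (forall x, f w <= f x) -> partial i f w = 0.
Proof.
move=> df fmin; apply/eqP; rewrite eq_le derive_at_min_ge0// andbT.
have := derive_at_min_ge0 (- delta_mx i 0) df fmin.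
by rewrite !deriveE// linearN oppr_ge0 /partial deriveE.
Qed.

Lemma is_derive_line f w h (t : R) : differentiable f (w + t *: h) ->
  is_derive t 1 (fun r : R => f (w + r *: h))
    (\sum_i h i 0 * partial i f (w + t *: h)).
Proof.
move=> df; rewrite -derive_sum_partial//.
(* The difference quotient of [f] along [h] is literally that of the restriction to the line, so
   derivability and the value transfer together. *)
have E : (fun r : R => r^-1 *: ((f \o shift (w + t *: h)) (r *: h)
    - f (w + t *: h))) = (fun r : R => r^-1 *:
    (((fun r : R => f (w + r *: h)) \o shift t) (r *: 1) - f (w + t *: h))).
  apply/funext => r /=; congr (_ *: (f _ - _)).
  by rewrite [r *: 1]mulr1 scalerDl addrCA addrC -!addrA.
apply: DeriveDef.
  by have := @diff_derivable _ _ _ _ _ h df; rewrite /derivable E.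
by rewrite /derive E.
Qed.

Lemma partial_expansion f w i c : 0 < c -> differentiable (partial i f) w ->
  \forall h \near (0 : 'cV[R]_d),
    `|partial i f (w + h) - partial i f w
      - \sum_j h j 0 * partial j (partial i f) w| <= c * `|h|.
Proof.
move=> c0 df; have := diff_locallyx df.
set k := 'o _ => E.
have := littleoP [littleo of k] c0; apply: filterS => h /=.
rewrite (addrC w) E -derive_sum_partial// deriveE//.
by rewrite (_ : _ - _ = k h)//; ring.
Qed.

(** The mean value theorem is applied on [0, 1] to f(w + t h) minus its quadratic model in t. The
    derivative of this difference pairs [h] with the first-order remainders of the partial
    derivatives, which [partial_expansion] controls. *)
Lemma taylor2 f w c : 0 < c -> C2_at f w ->
  \forall h \near (0 : 'cV[R]_d),
    `|f (w + h) - f w - \sum_i h i 0 * partial i f w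
      - 2^-1 * dotv h (hessian f w *m h)| <= c * dotv h h.
Proof.
move=> c0 [dfn _].
(* Each of the d coordinates will cost b |h|^2, for a total of at most c |h|^2; the added 1 covers d
   = 0. *)
pose b := c / (1 + d%:R); have b0 : 0 < b by rewrite divr_gt0// ltr_pwDl.
have df_near : \forall h \near (0 : 'cV[R]_d), differentiable f (w + h).
  move: dfn; rewrite (near_shift 0) subr0 => dfn; near=> h.
  have [] : differentiable f (h + w) /\
    forall i, differentiable (partial i f) (h + w) by near: h.
  by rewrite addrC.
have d2 i : differentiable (partial i f) w.
  by have [_ ] := nbhs_singleton dfn.
have exp_near : \forall h \near (0 : 'cV[R]_d), forall i,
    `|partial i f (w + h) - partial i f w
      - \sum_j h j 0 * partial j (partial i f) w| <= b * `|h|.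
  have H i := partial_expansion b0 (d2 i).
  exact: filter_forall H.
have [r /= r0 near_r] :=
  (nbhs_ballP (0 : 'cV[R]_d) _).1 (filterI df_near exp_near).
apply/(nbhs_ballP (0 : 'cV[R]_d)); exists r => //= h hr.
(* The whole segment from 0 to [h] stays in the ball, so the local estimates hold at the
   intermediate point of the mean value theorem. *)
have ball_line (t : R) : 0 <= t <= 1 -> ball 0 r (t *: h).
  move: hr; rewrite -!ball_normE /ball_/= !sub0r !normrN normrZ.
  move=> hr /andP[t0 t1].
  by rewrite (le_lt_trans _ hr)// ger0_norm// ler_piMl.
set B := \sum_i h i 0 * partial i f w; set Q := dotv h (hessian f w *m h).
pose psi (t : R) := f (w + t *: h) - t * B - t ^+ 2 * (2^-1 * Q).
pose dpsi (t : R) := \sum_i h i 0 * partial i f (w + t *: h) - B - t * Q.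
have dpsiP (t : R) : 0 <= t <= 1 -> is_derive t 1 psi (dpsi t).
  move=> /ball_line/near_r[/= /is_derive_line df1 _].
  have : is_derive t 1 (fun r : R => r * B) B.
    by apply: is_derive_eq; rewrite scaler0 add0r /GRing.scale/= mulr1.
  have : is_derive t 1 (fun r : R => r ^+ 2 * (2^-1 * Q)) (t * Q).
    by apply: is_derive_eq; rewrite scaler0 add0r /GRing.scale/=; field.
  move=> d2' d1'; exact: is_deriveB.
have [||s] := @MVT _ psi dpsi 0 1 ltr01.
- by move=> x; rewrite in_itv/= => /andP[x0 x1]; apply: dpsiP; rewrite !ltW.
- by apply: derivable_within_continuous => x; rewrite in_itv/= => /dpsiP[].
rewrite in_itv/= => /andP[/ltW s0 /ltW s1].
have -> : psi 1 - psi 0 = f (w + h) - f w - B - 2^-1 * Q.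
  by rewrite /psi scale1r scale0r addr0; ring.
rewrite subr0 mulr1 => ->.
have -> : dpsi s = \sum_i h i 0 * (partial i f (w + s *: h) - partial i f w
      - \sum_j (s *: h) j 0 * partial j (partial i f) w).
  under eq_bigr do rewrite !mulrBr.
  rewrite !sumrB; congr (_ - _ - _).
  rewrite /Q /dotv mulr_sumr; under eq_bigr do rewrite !mxE mulr_sumr mulr_sumr.
  (* Entry (i, j) of [hessian] applies [partial j] first, whereas the remainders sum over the outer
     derivative; exchanging the sums aligns the two. *)
  rewrite exchange_big; apply: eq_bigr => i _; rewrite mulr_sumr.
  by apply: eq_bigr => j _; rewrite !mxE; ring.
have [/= _ nr] := near_r _ (ball_line s (introT andP (conj s0 s1))).
rewrite (le_trans (ler_norm_sum _ _ _))//.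
(* The remainders were measured in the sup-norm, which the Euclidean norm dominates. *)
have hh : `|h| ^+ 2 <= dotv h h.
  by rewrite -sqr_norm2 ler_pXn2r ?nnegrE ?norm2_ge0// mx_norm_le_norm2.
apply: (@le_trans _ _ (\sum_(i < d) b * `|h| ^+ 2)).
  apply: ler_sum => i _; rewrite normrM expr2 mulrCA.
  rewrite ler_pM// ?normr_coord_le_mx_norm// (le_trans (nr i))//.
  by rewrite ler_wpM2l ?(ltW b0)// normrZ ger0_norm// ler_piMl.
have db : d%:R * b <= c.
  by rewrite mulrCA ler_piMr ?(ltW c0)// ler_pdivrMr ?ltr_pwDl// mul1r lerDr.
rewrite sumr_const card_ord -mulr_natl mulrA.
by apply: ler_pM; rewrite ?sqr_ge0 ?mulr_ge0 ?(ltW b0) ?(ltW c0).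
Unshelve. all: by end_near. Qed.

End taylor.

(** * Expansion of the minimiser of a perturbed criterion *)

Section argmin.
Context (R : realType) (d : nat).

(** Finite-dimensional core of the argument: along a fixed path, [f] stands for F(P, u), [Phi e] for
    F(P_e, u_e) and [g] for G(s, t). *)
Lemma argmin_expansion (f : 'cV[R]_d -> R) (w0 g : 'cV[R]_d)
    (Phi : R -> 'cV[R]_d -> R) (w : R -> 'cV[R]_d) :
  let H := hessian f w0 in
  C2_at f w0 -> posdefmx H -> (forall v, f w0 <= f v) ->
  w e @[e --> 0^'+] --> w0 ->
  (\forall e \near 0^'+, forall v, Phi e (w e) <= Phi e v) ->
  (forall v : R -> 'cV[R]_d, v e @[e --> 0^'+] --> w0 ->
    (fun e : R => Phi e (v e) - f (v e) - Phi e w0 + f w0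
       - e * dotv (v e - w0) g)
    =o_ (0^'+) (fun e : R => Num.max (norm2 (v e - w0) ^+ 2) (e ^+ 2))) ->
  (fun e : R => norm2 (w e - w0 - e *: - (invmx H *m g))) =o_ (0^'+)
    (fun e : R => e).
Proof.
move=> H fC2 posH fmin ww0 wmin expansion.
have [l l0 coercive] := posdefmx_coercive posH.
set x := invmx H *m g.
have Hx : H *m x = g by rewrite mulmxA mulmxV ?posdefmx_unitmx// mul1mx.
apply/eqoP => eta eta0.
(* [A] collects the e^2 errors in [key] below. The first bound on [c] lets the error 4 c |D|^2 be
   absorbed into l |D|^2 / 2, and the second makes what remains at most l (eta e)^2 / 4. *)
pose A := 1 + 3 * dotv x x.
have A0 : 0 < A by rewrite ltr_pwDl// mulr_ge0 ?dotvv_ge0.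
pose c := Num.min (l / 16) (l * eta ^+ 2 / (8 * A)).
have c0 : 0 < c by rewrite lt_min !divr_gt0 ?mulr_gt0 ?exprn_gt0.
have cl : c <= l / 16 by rewrite ge_min lexx.
have cA : c * A <= l * eta ^+ 2 / 8.
  rewrite -ler_pdivlMr// (le_trans (_ : _ <= l * eta ^+ 2 / (8 * A)))//.
    by rewrite ge_min lexx orbT.
  by rewrite invfM mulrA.
have grad0 i : partial i f w0 = 0.
  by apply: partial_at_min => //; have [/nbhs_singleton[]] := fC2.
have taylor (v : R -> 'cV[R]_d) : v e @[e --> 0^'+] --> w0 ->
    \forall e \near 0^'+, `|f (v e) - f w0
      - 2^-1 * dotv (v e - w0) (H *m (v e - w0))| <=
      c * dotv (v e - w0) (v e - w0).
  move=> vw0.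
  have : (v e - w0) @[e --> 0^'+] --> (0 : 'cV[R]_d).
    by rewrite -(subrr w0); apply: cvgB => //; exact: cvg_cst.
  move=> /(_ _ (taylor2 c0 fC2)) near_v; near=> e.
  have : `|f (w0 + (v e - w0)) - f w0
      - \sum_i (v e - w0) i 0 * partial i f w0
      - 2^-1 * dotv (v e - w0) (H *m (v e - w0))|
    <= c * dotv (v e - w0) (v e - w0) by near: e; exact: near_v.
  by rewrite big1 ?subr0 ?[w0 + _]addrC ?subrK// => i _; rewrite grad0 mulr0.
(* The competitor is the exact minimiser of the quadratic model k^T H k / 2 + e k^T g, with k the
   displacement from [w0]. *)
pose w1 (e : R) := w0 - e *: x.
have w1w0 : w1 e @[e --> 0^'+] --> w0.
  apply: cvg_at_right_filter; rewrite -[X in _ --> X]subr0 -(scale0r x).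
  apply: cvgB; [exact: cvg_cst|exact: scalel_continuous].
have /eqoP/(_ c c0) exp_w := expansion w ww0.
have /eqoP/(_ c c0) exp_w1 := expansion w1 w1w0.
near=> e.
have e0 : 0 < e by near: e; exact: nbhs_right_gt.
have taylor_w : `|f (w e) - f w0 - 2^-1 * dotv (w e - w0) (H *m (w e - w0))|
    <= c * dotv (w e - w0) (w e - w0) by near: e; exact: taylor.
have taylor_w1 : `|f (w1 e) - f w0
      - 2^-1 * dotv (w1 e - w0) (H *m (w1 e - w0))|
    <= c * dotv (w1 e - w0) (w1 e - w0) by near: e; exact: taylor.
have w_le : Phi e (w e) <= Phi e (w1 e).
  have : forall v, Phi e (w e) <= Phi e v by near: e.
  exact.
(* Replacing the maximum by a sum makes all error bounds linear in |h|^2 and e^2. *)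
have max_le (a b : R) : 0 <= a -> 0 <= b -> `|Num.max a b| <= a + b.
  by move=> a0 b0; rewrite ger0_norm ?le_max ?a0// ge_max lerDl lerDr a0 b0.
have exp_we : `|Phi e (w e) - f (w e) - Phi e w0 + f w0
    - e * dotv (w e - w0) g| <= c * (dotv (w e - w0) (w e - w0) + e ^+ 2).
  apply: le_trans (_ : c * `|Num.max (norm2 (w e - w0) ^+ 2) (e ^+ 2)| <= _).
    by near: e.
  by rewrite ler_pM2l// sqr_norm2 max_le ?dotvv_ge0 ?sqr_ge0.
have exp_w1e : `|Phi e (w1 e) - f (w1 e) - Phi e w0 + f w0
    - e * dotv (w1 e - w0) g| <= c * (dotv (w1 e - w0) (w1 e - w0) + e ^+ 2).
  apply: le_trans (_ : c * `|Num.max (norm2 (w1 e - w0) ^+ 2) (e ^+ 2)| <= _).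
    by near: e.
  by rewrite ler_pM2l// sqr_norm2 max_le ?dotvv_ge0 ?sqr_ge0.
have w1B : w1 e - w0 = - (e *: x) by rewrite /w1 addrAC subrr add0r.
rewrite w1B mulmxN -scalemxAr Hx in taylor_w1.
rewrite w1B in exp_w1e.
set h := w e - w0 in taylor_w exp_we *.
have -> : h - e *: - x = h + e *: x by rewrite scalerN opprK.
set D := h + e *: x.
have symH : H^T = H by have [] := posH.
(* Completing the square: D^T H D = h^T H h + 2 e h^T g + e^2 x^T g. *)
have DD := dotv_quad_shift h x e symH; rewrite Hx -/D in DD.
have exe v : dotv (- (e *: x)) (- (e *: v)) = e ^+ 2 * dotv x v.
  by rewrite dotvNl dotvNr opprK dotvZl dotvZr mulrA.
have hh : dotv h h <= 2 * dotv D D + 2 * (e ^+ 2 * dotv x x).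
  have := dotvv_add_le D (- (e *: x)).
  by rewrite exe /D addrK.
have lD := coercive D.
rewrite !exe in taylor_w1.
rewrite exe dotvNl dotvZl mulrN mulrA -expr2 in exp_w1e.
(* Chaining [w_le] with the two Taylor bounds and the two expansions gives D^T H D / 2 <= 2 c (|h|^2
   + e^2 |x|^2 + e^2); then [hh] and coercivity leave only |D|^2 and e^2. *)
have key : l / 2 * dotv D D <= 4 * c * dotv D D + 2 * (c * A) * e ^+ 2.
  have hc : c * dotv h h <= c * (2 * dotv D D + 2 * (e ^+ 2 * dotv x x)).
    by rewrite ler_pM2l.
  move: taylor_w taylor_w1 exp_we exp_w1e; rewrite !ler_norml /A; lra.
have D0 := dotvv_ge0 D.
have cD : c * dotv D D <= l / 16 * dotv D D by rewrite ler_wpM2r.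
have cAe : c * A * e ^+ 2 <= l * eta ^+ 2 / 8 * e ^+ 2.
  by rewrite ler_wpM2r ?sqr_ge0.
have : l * dotv D D <= l * (eta * e) ^+ 2 by rewrite exprMn; lra.
rewrite ler_pM2l// => De.
rewrite (gtr0_norm e0) ger0_norm ?norm2_ge0// -(ler_pXn2r (ltn0Sn 1)).
- by rewrite sqr_norm2.
- exact: norm2_ge0.
- by rewrite nnegrE mulr_ge0 ?(ltW eta0) ?(ltW e0).
Unshelve. all: by end_near. Qed.

End argmin.

(** * Quadratic mean differentiable paths converge in Hellinger distance *)

Section qmd_paths.
Context (dsp : measure_display) (Z : measurableType dsp) (R : realType).
Implicit Types P Q : probability Z R.

Lemma dominates_dominatingr P Q : Q `<< dominating P Q.
Proof.
move=> A A0 B mB BA; apply/eqP.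
have := A0 B mB BA; rewrite /dominating measure_addE => /eqP.
by rewrite padde_eq0// => /andP[].
Qed.

Lemma dominates_dominatingl P Q : P `<< dominating P Q.
Proof.
move=> A A0 B mB BA; apply/eqP.
have := A0 B mB BA; rewrite /dominating measure_addE => /eqP.
by rewrite padde_eq0// => /andP[].
Qed.

Lemma measurable_sqrt_density P Q P0 : P0 `<< dominating P Q ->
  measurable_fun setT (sqrt_density P Q P0).
Proof.
move=> dP0; apply: measurableT_comp; last first.
  apply: measurableT_comp; first exact: fine_measurable.
  exact: measurable_int (Radon_Nikodym_integrable _).
by apply: continuous_measurable_fun => x; exact: sqrt_continuous.
Qed.

Lemma integral_sqrt_density P Q (f : Z -> R) : measurable_fun setT f ->
  (forall z, 0 <= f z) ->
  (\int[dominating P Q]_z (f z * sqrt_density P Q Q z ^+ 2)%:E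
   = \int[Q]_z (f z)%:E)%E.
Proof.
move=> mf f0; have dQ := @dominates_dominatingr P Q.
rewrite -(Radon_Nikodym_SigmaFinite.change_of_variables dQ)//; last first.
  exact/measurable_EFinP.
apply: ge0_ae_eq_integral => //.
- apply/measurable_EFinP/measurable_funM => //.
  exact/measurable_funX/measurable_sqrt_density.
- apply: emeasurable_funM; first exact/measurable_EFinP.
  exact: measurable_int (Radon_Nikodym_SigmaFinite.f_integrable dQ).
- by move=> z _; rewrite lee_fin mulr_ge0// sqr_ge0.
- by move=> z _; rewrite mule_ge0 ?lee_fin// Radon_Nikodym_SigmaFinite.f_ge0.
(* The charge derivative inside [sqrt_density] agrees almost everywhere with the sigma-finite one,
   which is finite and nonnegative, so squaring the root recovers the density. *)
have := ae_eq_Radon_Nikodym_SigmaFinite dQ measurableT.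
apply: filterS => z /(_ I) E _; rewrite EFinM /sqrt_density -E sqr_sqrtr.
  by rewrite fineK// Radon_Nikodym_SigmaFinite.f_fin_num.
by rewrite fine_ge0// Radon_Nikodym_SigmaFinite.f_ge0.
Qed.

Lemma integral_hellinger_le M P (s : L2 P) (Pe : R -> probability Z R) :
  qmd_path M s Pe -> exists2 K : R, 0 <= K &
    \forall e \near 0^'+, hellinger (Pe e) P ^+ 2 <= K * e ^+ 2.
Proof.
move=> [_ _ /(_ 1 ltr01) qmd].
have s2 : (\int[P]_z (s z ^+ 2)%:E < +oo)%E.
  have /integrableP[_] := Lfun2_integrable_sqr (LfunP s).
  apply: le_lt_trans; rewrite le_eqVlt; apply/orP; left; apply/eqP.
  by apply: eq_integral => z _ /=; rewrite ger0_norm ?sqr_ge0.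
have s20 : (0 <= \int[P]_z (s z ^+ 2)%:E)%E.
  by apply: integral_ge0 => z _; rewrite lee_fin sqr_ge0.
have ms : measurable_fun setT (fun z => s z ^+ 2).
  exact/measurable_funX.
set S := (\int[P]_z (s z ^+ 2)%:E)%E in s2 s20.
have SE : S = (fine S)%:E by rewrite fineK// ge0_fin_numE.
(* With r the remainder in quadratic mean, (pe - p)^2 <= 2 r^2 + 2 (e s p / 2)^2; the integral of
   r^2 is at most e^2, and that of s^2 p^2 is [S]. *)
exists (2 + fine S / 2); first by rewrite addr_ge0// divr_ge0// fine_ge0.
near=> e.
have qmd_e : (\int[dominating (Pe e) P]_z
   ((sqrt_density (Pe e) P (Pe e) z - sqrt_density (Pe e) P P z
     - e / 2 * s z * sqrt_density (Pe e) P P z) ^+ 2)%:E <= (1 * e ^+ 2)%:E)%E.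
  by near: e.
set nu := dominating (Pe e) P in qmd_e *.
set pe := sqrt_density (Pe e) P (Pe e) in qmd_e *.
set p := sqrt_density (Pe e) P P in qmd_e *.
have mp : measurable_fun setT p.
  exact/measurable_sqrt_density/dominates_dominatingr.
have mpe : measurable_fun setT pe.
  apply: measurable_sqrt_density; exact: dominates_dominatingl.
have mr : measurable_fun setT (fun z => pe z - p z - e / 2 * s z * p z).
  apply: measurable_funB; first exact: measurable_funB.
  by apply: measurable_funM => //; exact: measurable_funM.
have msp : measurable_fun setT (fun z => s z ^+ 2 * p z ^+ 2).
  by apply: measurable_funM => //; exact: measurable_funX.
have e2 : 0 <= e ^+ 2 / 2 by rewrite divr_ge0// sqr_ge0.
have sp0 z : 0 <= s z ^+ 2 * p z ^+ 2 by rewrite mulr_ge0 ?sqr_ge0.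
have bound : (\int[nu]_z ((pe z - p z) ^+ 2)%:E
    <= ((2 + fine S / 2) * e ^+ 2)%:E)%E.
  apply: (@le_trans _ _ (\int[nu]_z
    (2%:E * ((pe z - p z - e / 2 * s z * p z) ^+ 2)%:E
     + (e ^+ 2 / 2)%:E * (s z ^+ 2 * p z ^+ 2)%:E))%E).
    apply: ge0_le_integral => //.
    - by move=> z _; rewrite lee_fin sqr_ge0.
    - exact/measurable_EFinP/measurable_funX/measurable_funB.
    - apply/measurable_EFinP/measurable_funD; apply: measurable_funM => //.
      exact: measurable_funX.
    - move=> z _; rewrite -!EFinM -EFinD lee_fin.
      (* This is (a + b)^2 <= 2 a^2 + 2 b^2, obtained from (a - b)^2 >= 0. *)
      have := sqr_ge0 (pe z - p z - e / 2 * s z * p z - e / 2 * s z * p z).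
      nra.
  rewrite ge0_integralD//; last 4 first.
  - by move=> z _; rewrite -EFinM lee_fin mulr_ge0// sqr_ge0.
  - by apply/measurable_EFinP/measurable_funM => //; exact: measurable_funX.
  - by move=> z _; rewrite -EFinM lee_fin mulr_ge0.
  - exact/measurable_EFinP/measurable_funM.
  rewrite !ge0_integralZl_EFin//; last 4 first.
  - by move=> z _; rewrite lee_fin.
  - exact/measurable_EFinP.
  - by move=> z _; rewrite lee_fin sqr_ge0.
  - exact/measurable_EFinP/measurable_funX.
  rewrite integral_sqrt_density//; last by move=> z; exact: sqr_ge0.
  rewrite -/S SE; set k := fine S.
  have -> : ((2 + fine k%:E / 2) * e ^+ 2)%:E
      = (2%:E * (e ^+ 2)%:E + (e ^+ 2 / 2)%:E * k%:E)%E.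
    by rewrite -!EFinM -EFinD /=; congr _%:E; field.
  by rewrite leeD// lee_wpmul2l//; move: qmd_e; rewrite (mul1r (e ^+ 2)).
(* [hellinger] uses the real-valued integral, so finiteness of the extended one is needed to
   transfer the bound. *)
rewrite /hellinger sqr_sqrtr; last first.
  by apply: Rintegral_ge0 => z _; exact: sqr_ge0.
rewrite -lee_fin fineK//.
rewrite ge0_fin_numE; first exact: le_lt_trans bound (ltry _).
by apply: integral_ge0 => z _; rewrite lee_fin sqr_ge0.
Unshelve. all: by end_near. Qed.

Lemma qmd_path_hellinger M P (s : L2 P) (Pe : R -> probability Z R) :
  qmd_path M s Pe -> forall c : R, 0 < c ->
  \forall e \near 0^'+, hellinger (Pe e) P < c.
Proof.
move=> /integral_hellinger_le[K K0 HK] c c0.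
have K1 : 0 < 1 + K by rewrite ltr_pwDl.
near=> e.
have e0 : 0 < e by near: e; exact: nbhs_right_gt.
(* Since K <= (1 + K)^2, this gives K e^2 <= (e (1 + K))^2 < c^2. *)
have e1 : e < c / (1 + K).
  by near: e; apply: nbhs_right_lt; rewrite divr_gt0.
have He : hellinger (Pe e) P ^+ 2 <= K * e ^+ 2 by near: e.
rewrite -(ltr_pXn2r (ltn0Sn 1)) ?nnegrE ?sqrtr_ge0 ?ltW//.
rewrite (le_lt_trans He)//.
move: e1; rewrite ltr_pdivlMr// => e1.
have : (e * (1 + K)) ^+ 2 < c ^+ 2.
  by rewrite ltr_pXn2r ?nnegrE ?mulr_ge0// ltW.
apply: le_lt_trans; rewrite exprMn mulrC ler_wpM2l ?sqr_ge0//; nra.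
Unshelve. all: by end_near. Qed.

End qmd_paths.

(** * Tangent spaces and inner products under negation, for the sign in the adjoint *)

Section tangent_sums.
Context (dsp : measure_display) (Z : measurableType dsp) (R : realType).
Context (T : completeNormedModType R) (ip : {dot T for idfun}).
Context (M : set (probability Z R)) (U : set T).
Context (P : probability Z R) (u : T).

Lemma linspan_opp (V : lmodType R) (A : set V) x :
  linspan A x -> linspan A (- x).
Proof.
move=> [n [a [v [Av ->]]]]; exists n, (fun i => - a i), v; split => //.
by rewrite -sumrN; apply: eq_bigr => i _; rewrite scaleNr.
Qed.

Lemma tangent_spaceM_opp (s : L2 P) :
  tangent_spaceM M P s -> tangent_spaceM M P (- s).
Proof.
move=> sM c /sM[g gM gc]; exists (- g); first exact: linspan_opp.
rewrite -opprD.
have -> : EFin \o (- (s - g))%R = (\- (EFin \o (s - g)%R))%E by apply/funext.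
by rewrite oppe_Lnorm.
Qed.

Lemma tangent_spaceU_opp (t : T) :
  tangent_spaceU U u t -> tangent_spaceU U u (- t).
Proof.
move=> tU B Bt; have : nbhs t (-%R @^-1` B) by exact: opp_continuous Bt.
by move=> /tU[x [xU Bx]]; exists (- x); split => //; exact: linspan_opp.
Qed.

Lemma ipL2_oppl (s s' : L2 P) : ipL2 (- s) s' = - ipL2 s s'.
Proof.
rewrite /ipL2 -mulN1r -RintegralZl//; last first.
  (* Linearity of the integral requires a product of two square-integrable functions to be
     integrable. *)
  exact/Lfun1_integrable/Lfun2_mul_Lfun1/LfunP/LfunP.
by apply: eq_Rintegral => z _; rewrite mulN1r -mulNr.
Qed.

Lemma ip_sum_oppl (x y : L2 P * T) : ip_sum ip (- x) y = - ip_sum ip x y.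
Proof.
by rewrite /ip_sum ipL2_oppl opprD; congr (_ + _); rewrite linearNl.
Qed.

End tangent_sums.

(** * Paths in the Hilbert space converge to their base point *)

Section hilbert_paths.
Context (R : realType) (T : completeNormedModType R).

Lemma hilbert_path_cvg (U : set T) (u t : T) (ue : R -> T) :
  hilbert_path U u t ue -> ue e @[e --> 0^'+] --> u.
Proof.
move=> [_ /eqoP/(_ 1 ltr01) ho]; apply/cvgrPdist_lt => c c0.
have K0 : 0 < 1 + `|t| by rewrite ltr_pwDl.
near=> e.
have e0 : 0 < e by near: e; exact: nbhs_right_gt.
have ec : e < c / (1 + `|t|).
  by near: e; apply: nbhs_right_lt; rewrite divr_gt0.
have oe : `|ue e - u - e *: t| <= 1 * `|e| by near: e.
rewrite distrC -(subrK (e *: t) (ue e - u)) (le_lt_trans (ler_normD _ _))//.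
(* The remainder contributes at most e and the linear term e |t|. *)
rewrite (@le_lt_trans _ _ (e * (1 + `|t|))) -?ltr_pdivlMr//.
rewrite mulrDr mulr1 normrZ lerD ?gtr0_norm//.
by move: oe; rewrite mul1r gtr0_norm.
Unshelve. all: by end_near. Qed.

End hilbert_paths.

(* Sign and order: minimising h^T H h / 2 + e h^T G(s, t) over h gives
   h = - e H^-1 G(s, t), and as H^-1 acts on R^d the adjoint of - H^-1 G is
   w |-> - G^*(H^-1 w). *)
Theorem lemmaS14 (R : realType) (dsp : measure_display) (Z : measurableType dsp)
  (M : set (probability Z R))
  (T : completeNormedModType R) (ip : {dot T for idfun})
  (hilbT : hilbert_norm ip) (U : set T) (d : nat)
  (F : 'cV[R]_d -> probability Z R -> T -> R)
  (theta : probability Z R -> T -> 'cV[R]_d)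
  (theta_argmin : forall P' u', M P' -> U u' ->
     forall w, F (theta P' u') P' u' <= F w P' u')
  (P : probability Z R) (u : T) (MP : M P) (Uu : U u)
  (nonparam : locally_nonparametric M P)
  (theta_cont : continuous_at_model M U P u theta)
  (F_C2 : C2_at (fun w => F w P u) (theta P u))
  (F_posdef : posdefmx (hessian (fun w => F w P u) (theta P u)))
  (G : L2 P * T -> 'cV[R]_d)
  (G_bounded : bounded_linear_op ip M U u (@dotv R d) G)
  (G_expansion : forall (s : L2 P) (t : T)
     (Pe : R -> probability Z R) (ue : R -> T) (w : R -> 'cV[R]_d),
     qmd_path M s Pe -> hilbert_path U u t ue ->
     w e @[e --> 0^'+] --> theta P u ->
     (fun e : R => F (w e) (Pe e) (ue e) - F (w e) P u
               - F (theta P u) (Pe e) (ue e) + F (theta P u) P u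
               - e * dotv (w e - theta P u) (G (s, t)))
       =o_ (0^'+)
         (fun e : R => Num.max (norm2 (w e - theta P u) ^+ 2) (e ^+ 2))) :
  let H := hessian (fun w => F w P u) (theta P u) in
  total_pathwise_derivative ip M U u (@dotv R d) theta
    (fun x => - (invmx H *m G x)) /\
  forall Gadj : 'cV[R]_d -> L2 P * T,
    hermitian_adjoint ip M U u (@dotv R d) G Gadj ->
    hermitian_adjoint ip M U u (@dotv R d) (fun x => - (invmx H *m G x))
      (fun w => - Gadj (invmx H *m w)).
Proof.
move=> H; have [symH posH] := F_posdef; split; last first.
  (* H^-1 is symmetric, so w.(H^-1 G x) = (H^-1 w).(G x), and the identity defining [Gadj] applies
     at H^-1 w. *)
  move=> Gadj GadjP w; have [[gM gU] gE] := GadjP (invmx H *m w).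
  split; first by split; [exact: tangent_spaceM_opp|exact: tangent_spaceU_opp].
  move=> x xM; rewrite ip_sum_oppl -(gE x xM) dotvNr; congr (- _).
  by rewrite dotv_mulmxr trmx_inv symH.
split; [split|].
- move=> a x y xM yM; have [Glin _] := G_bounded; rewrite (Glin a x y xM yM).
  by rewrite mulmxDr -scalemxAr opprD scalerN.
- have [_ [C leC]] := G_bounded.
  have [K K0 leK] := mulmx_dotv_bounded (invmx H).
  (* [Num.sqrt K] bounds the Euclidean operator norm of H^-1, and [C] bounds [G]. *)
  exists (Num.sqrt K * C) => x xM.
  rewrite -mulrA (le_trans _ (ler_wpM2l (sqrtr_ge0 _) (leC _ xM)))//.
  by rewrite /normW dotvNl dotvNr opprK -sqrtrM ?(ltW K0)// ler_wsqrtr.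
move=> s t Pe ue qPe hue.
have ue0 : ue e @[e --> 0^'+] --> u.
  exact: hilbert_path_cvg hue.
(* Paths are constrained only on [0, 1], so membership in the model holds only for small e. *)
have M01 : \forall e \near 0^'+, M (Pe e) /\ U (ue e).
  near=> e; have e01 : 0 <= e <= 1.
    apply/andP; split; near: e; first exact: nbhs_right_ge.
    exact: nbhs_right_le.
  by have [[+ _ _] [+ _]] := (qPe, hue) => /(_ _ e01)? /(_ _ e01)?.
have ww0 : theta (Pe e) (ue e) @[e --> 0^'+] --> theta P u.
  apply/cvgrPdist_lt => c c0; have [r r0 thr] := theta_cont c c0.
  near=> e; rewrite distrC (le_lt_trans (mx_norm_le_norm2 _))//.
  have [MPe Uue] : M (Pe e) /\ U (ue e) by near: e.
  apply: thr => //; near: e; first exact: qmd_path_hellinger qPe _ r0.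
  by move/cvgrPdist_lt : ue0 => /(_ r r0); apply: filterS => e; rewrite distrC.
apply: (@argmin_expansion _ _ (fun w => F w P u) _ _
  (fun e w => F w (Pe e) (ue e))) => //.
- by move=> v; exact: theta_argmin.
- by apply: filterS M01 => e [MPe Uue] v; exact: theta_argmin.
- by move=> v vw0; exact: G_expansion.
Unshelve. all: by end_near. Qed.
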